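(* Let $n\in\mathbb{N}$. For $p,u\in\mathbb{R}^n$ with $p_i>0$ and $u_i>0$ for all $i$, consider the assortment game $$\nu_{p,u}(w)=\max_{x\in\{0,1\}^n}\left[\frac{\sum_{i=1}^n p_ie^{u_i}x_i}{1+\sum_{i=1}^n e^{u_i}x_i}:\ x\le w\right],\qquad w\in\{0,1\}^n.$$ The smallest $\gamma\ge 1$ such that the $\gamma$-core of every assortment game with $n$ products is non-empty is $n$; that is, the $n$-core of $\nu_{p,u}$ is non-empty for all such $p,u$, and for every $1\le\gamma<n$ there exist such $p,u$ for which the $\gamma$-core of $\nu_{p,u}$ is empty.
   Context: For $\gamma\ge 1$, the $\gamma$-core of a game $\nu:\{0,1\}^n\to\mathbb{R}$ is $\{y\in\mathbb{R}^n:\ \mathbf{1}_n^Ty\le\gamma\,\nu(\mathbf{1}_n),\ a^Ty\ge\nu(a)\ \forall a\in\{0,1\}^n\}$, where $\mathbf{1}_n$ is the all-one vector. Vector inequalities are componentwise. *)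

(* Defs.v *)
From mathcomp Require Import all_boot all_order all_algebra.
From mathcomp Require Import all_classical all_reals all_analysis.

Set Implicit Arguments.
Unset Strict Implicit.
Unset Printing Implicit Defensive.

Import Order.TTheory GRing.Theory Num.Theory.

Local Open Scope classical_set_scope.
Local Open Scope ring_scope.

(* A vector of {0,1}^n is a boolean row vector; [true] and [false] are read as
   1 and 0, in particular by the coercion of bool to nat under [%:R]. *)

Definition le01 (n : nat) (x w : 'rV[bool]_n) : bool :=
  [forall i, x 0 i ==> w 0 i].

Definition gamma_core (R : realType) (n : nat) (gamma : R)
    (nu : 'rV[bool]_n -> R) : set 'rV[R]_n :=
  [set y : 'rV[R]_n |
    \sum_(i < n) y 0 i <= gamma * nu (const_mx true) /\
    forall a : 'rV[bool]_n, nu a <= \sum_(i < n) (a 0 i)%:R * y 0 i].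

Definition revenue (R : realType) (n : nat) (p u : 'rV[R]_n)
    (x : 'rV[bool]_n) : R :=
  (\sum_(i < n) p 0 i * expR (u 0 i) * (x 0 i)%:R) /
  (1 + \sum_(i < n) expR (u 0 i) * (x 0 i)%:R).

(* The maximum of [revenue p u x] over x <= w.  The start value of the iterated
   maximum is attained at the feasible point x = w, so it does not affect the
   result. *)
Definition assortment_game (R : realType) (n : nat) (p u : 'rV[R]_n)
    (w : 'rV[bool]_n) : R :=
  \big[Num.max/revenue p u w]_(x : 'rV[bool]_n | le01 x w) revenue p u x.

(* Main.v *)
Require Import Defs.
From mathcomp Require Import all_boot all_order all_algebra.
From mathcomp Require Import all_classical all_reals all_analysis.
From mathcomp Require Import lra.

Set Implicit Arguments.
Unset Strict Implicit.
Unset Printing Implicit Defensive.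

Import Order.TTheory GRing.Theory Num.Theory.

Local Open Scope classical_set_scope.
Local Open Scope ring_scope.

(** Write [s i = p_i e^{u_i} / (1 + e^{u_i})] ([single_revenue]) for the revenue
    of product [i] offered alone; the game value of every coalition containing
    [i] is at least [s i] ([single_revenue_le_game]).

    The vector [s] lies in the [n]-core.  Offering more products only
    increases the denominator of the revenue, so each offered product [i]
    contributes at most [s i] to [revenue p u x]; hence the value of [a] is at
    most the sum of [s i] over [a] ([revenue_le_sum_single]).  The grand
    coalition is worth at least each [s i], so the [n] coordinates of [s] add
    up to at most [n] times that value.

    The factor [n] cannot be lowered.  Any vector of the [gamma]-core dominates
    [s], so the sum of the [s i] is at most [gamma] times the value of the grand
    coalition ([sum_single_revenue_le]).  When all prices are 1 and all
    utilities equal [v], every revenue is at most 1, whereas the sum of the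
    [s i] is [n e^v / (1 + e^v)], which exceeds any given [gamma < n] once
    [e^v > gamma / (n - gamma)]; the choice [v = gamma / (n - gamma)] suffices
    because [v < e^v]. *)

(** The indicator vector of the singleton coalition [i]. *)
Definition single (n : nat) (i : 'I_n) : 'rV[bool]_n := \row_j (j == i).

(** The revenue of product [i] offered alone, in closed form; [revenue_single]
    identifies it with [revenue] at the coalition [single i]. *)
Definition single_revenue (R : realType) (n : nat) (p u : 'rV[R]_n)
    (i : 'I_n) : R :=
  p 0 i * expR (u 0 i) / (1 + expR (u 0 i)).

Lemma le01_refl n (w : 'rV[bool]_n) : le01 w w.
Proof. by apply/forallP => i; exact: implybb. Qed.

Lemma sum_single (R : realType) n (f : 'I_n -> R) i :
  \sum_(j < n) f j * (single i 0 j)%:R = f i.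
Proof.
rewrite (bigD1 i) //= big1 ?addr0; last first.
  by move=> j ji; rewrite mxE (negbTE ji) mulr0.
by rewrite mxE eqxx mulr1.
Qed.

Lemma revenue_single (R : realType) n (p u : 'rV[R]_n) i :
  revenue p u (single i) = single_revenue p u i.
Proof.
rewrite /revenue (sum_single (fun j => p 0 j * expR (u 0 j))).
by rewrite (sum_single (fun j => expR (u 0 j))).
Qed.

Lemma revenue_le_game (R : realType) n (p u : 'rV[R]_n) x w :
  le01 x w -> revenue p u x <= assortment_game p u w.
Proof. by move=> xw; exact: le_bigmax_cond. Qed.

Lemma game_le (R : realType) n (p u : 'rV[R]_n) w (c : R) :
  (forall x, le01 x w -> revenue p u x <= c) -> assortment_game p u w <= c.
Proof. by move=> h; apply: bigmax_le => //; apply/h/le01_refl. Qed.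

Lemma single_revenue_le_game (R : realType) n (p u : 'rV[R]_n) (i : 'I_n)
    (w : 'rV[bool]_n) :
  w 0 i -> single_revenue p u i <= assortment_game p u w.
Proof.
move=> wi; rewrite -revenue_single; apply: revenue_le_game.
by apply/forallP => j; rewrite mxE; apply/implyP => /eqP ->.
Qed.

Lemma weight_sum_ge0 (R : realType) n (u : 'rV[R]_n) (x : 'rV[bool]_n) :
  0 <= \sum_(i < n) expR (u 0 i) * (x 0 i)%:R.
Proof. by apply: sumr_ge0 => i _; rewrite mulr_ge0 ?expR_ge0. Qed.

Lemma revenue_le_sum_single (R : realType) n (p u : 'rV[R]_n)
    (x a : 'rV[bool]_n) :
  (forall i, 0 <= p 0 i) -> le01 x a ->
  revenue p u x <= \sum_(i < n) (a 0 i)%:R * single_revenue p u i.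
Proof.
move=> p0 /forallP xa; rewrite /revenue mulr_suml; apply: ler_sum => i _.
have s0 : 0 <= single_revenue p u i.
  by rewrite divr_ge0 ?mulr_ge0 ?addr_ge0 ?expR_ge0.
(* If [i] is offered, the full denominator is at least [1 + expR (u 0 i)]. *)
have [xi|xi] := boolP (x 0 i); last by rewrite mulr0 mul0r mulr_ge0.
rewrite (implyP (xa i) xi) mulr1 mul1r.
apply: ler_wpM2l; first by rewrite mulr_ge0 ?expR_ge0.
rewrite lef_pV2 ?posrE ?ltr_pwDl ?weight_sum_ge0 ?expR_ge0 //.
rewrite lerD2l (bigD1 i) //= xi mulr1 lerDl.
by apply: sumr_ge0 => j _; rewrite mulr_ge0 ?expR_ge0.
Qed.

Lemma single_revenue_in_core (R : realType) n (p u : 'rV[R]_n) :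
  (forall i, 0 <= p 0 i) ->
  gamma_core n%:R (assortment_game p u) (\row_i single_revenue p u i).
Proof.
move=> p0; split.
  rewrite mulr_natl -[X in _ *+ X]card_ord -sumr_const.
  by apply: ler_sum => i _; rewrite mxE single_revenue_le_game ?mxE.
move=> a; apply: game_le => x xa.
under eq_bigr do rewrite mxE.
exact: revenue_le_sum_single.
Qed.

Lemma sum_single_revenue_le (R : realType) n (gamma : R) (p u y : 'rV[R]_n) :
  gamma_core gamma (assortment_game p u) y ->
  \sum_(i < n) single_revenue p u i
    <= gamma * assortment_game p u (const_mx true).
Proof.
move=> [ysum ycov]; apply: le_trans ysum; apply: ler_sum => i _.
apply: (@le_trans _ _ (assortment_game p u (single i))).
  by apply: single_revenue_le_game; rewrite mxE eqxx.
apply: le_trans (ycov _) _.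
under eq_bigr do rewrite mulrC.
by rewrite (sum_single (fun j => y 0 j)).
Qed.

Lemma unit_price_game_le1 (R : realType) n (u : 'rV[R]_n) w :
  assortment_game (const_mx 1) u w <= 1.
Proof.
apply: game_le => x _; rewrite /revenue.
under eq_bigr do rewrite mxE mul1r.
by rewrite ler_pdivrMr ?ltr_pwDl ?weight_sum_ge0 // mul1r lerDr.
Qed.

Lemma unit_price_core_empty (R : realType) n (gamma v : R) :
  0 <= gamma -> gamma * (1 + expR v) < n%:R * expR v ->
  gamma_core gamma (assortment_game (const_mx 1) (const_mx v : 'rV[R]_n))
    = set0.
Proof.
move=> g0 gv; apply/seteqP; split=> // y /sum_single_revenue_le ysum.
have : \sum_(i < n) single_revenue (const_mx 1) (const_mx v : 'rV[R]_n) i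
    <= gamma.
  apply: (le_trans ysum); rewrite -[leRHS]mulr1.
  exact: ler_wpM2l (unit_price_game_le1 _ _).
rewrite /single_revenue; under eq_bigr do rewrite !mxE mul1r.
rewrite sumr_const card_ord -mulr_natl mulrA.
rewrite ler_pdivrMr ?ltr_pwDl ?expR_ge0 // => /(lt_le_trans gv).
by rewrite ltxx.
Qed.

Theorem fact2 (R : realType) (n : nat) (hn : (0 < n)%N) :
  [/\ 1 <= n%:R :> R,
      forall p u : 'rV[R]_n,
        (forall i, 0 < p 0 i) -> (forall i, 0 < u 0 i) ->
        gamma_core n%:R (assortment_game p u) !=set0
    & forall gamma : R, 1 <= gamma -> gamma < n%:R ->
        exists p u : 'rV[R]_n,
          [/\ forall i, 0 < p 0 i, forall i, 0 < u 0 i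
            & gamma_core gamma (assortment_game p u) = set0]].
Proof.
split; first by rewrite ler1n.
  move=> p u p0 _; exists (\row_i single_revenue p u i).
  by apply: single_revenue_in_core => i; exact: ltW.
move=> gamma g1 gn.
have g0 : 0 < gamma by exact: lt_le_trans g1.
have gap : 0 < n%:R - gamma by rewrite subr_gt0.
pose v := gamma / (n%:R - gamma).
exists (const_mx 1), (const_mx v); split=> [i|i|]; rewrite ?mxE ?divr_gt0 //.
apply: unit_price_core_empty; first exact: ltW.
have : v < expR v by apply: lt_le_trans (expR_ge1Dx v); rewrite ltrDr.
by rewrite ltr_pdivrMr // => h; lra.
Qed.
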